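(* Let $m$ be a natural number. For any colouring of the edges of the complete graph on $\mathbb{N}$ with finitely many colours in which at least $m$ colours are used, there exist a natural number $\hat m$ satisfying \[|m-\hat m|\le \sqrt{m/2}+\tfrac12\] and an infinite set $X\subset\mathbb{N}$ such that exactly $\hat m$ colours appear on the edges of the complete graph on $X$.
   Context: Natural numbers are positive integers, $\mathbb{N}=\{1,2,\dots\}$. The edges of the complete graph on a set $X$ are the $2$-element subsets of $X$; a colouring assigns a colour to each edge (it need not be a proper colouring). *)

(* Defs.v *)
From mathcomp Require Import all_boot all_order all_algebra.
From mathcomp Require Import classical_sets functions cardinality reals.

Set Implicit Arguments.
Unset Strict Implicit.
Unset Printing Implicit Defensive.

Local Open Scope classical_set_scope.

Definition posN : set nat := [set n | (0 < n)%N].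

Definition edges (X : set nat) : set (set nat) :=
  [set e | e `<=` X /\ (e #= `I_2)%card].

(* A colouring of the edges of the complete graph on X is represented by a
   function c on all sets of naturals; only its values on edges X are used. *)
Definition colours (K : Type) (c : set nat -> K) (X : set nat) : set K :=
  c @` edges X.

(* Main.v *)
Require Import Defs.
From mathcomp Require Import all_boot all_order all_algebra.
From mathcomp Require Import classical_sets functions cardinality reals.
From mathcomp Require Import boolp filter zify lra.

Set Implicit Arguments.
Unset Strict Implicit.
Unset Printing Implicit Defensive.

Import Order.TTheory GRing.Theory Num.Theory.
Local Open Scope classical_set_scope.
Local Open Scope ring_scope.

(** A non-principal ultrafilter reduces the problem to a finite one. For every
    vertex [a] it selects a colour [f a] carried by the edges from [a] to almost
    all vertices, and for almost all [a] this is one fixed colour [c0]. Hence any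
    finite vertex set is completed by an infinite set [Y] whose own edges all
    have colour [c0] and which each vertex [a] of the finite set sees in the
    single colour [f a] ([homogeneous_tail]). Choose a finite vertex set that
    exhibits every colour; for a subset [B] of it, the colours on [B] and [Y]
    together are [c0], the [f a] with [a] in [B], and those of the edges inside
    [B]. Regarding [f a] as the colour of a loop at [a], this is the palette of
    [B]: the colour [c0] together with all [e u v] for [u], [v] in [B].

    It remains to find [B] whose palette has nearly [m] colours
    ([palette_near]). Take [B] inclusion-minimal among the sets with at least [m]
    colours; suppose that it has more than [m]. Deleting a vertex [v] loses at
    most as many colours as [B] has vertices, since a lost colour is carried by
    an edge or loop at [v]. A colour other than [c0] is lost by at most two
    deletions, those of the ends of one edge carrying it. So if [n] is the size
    of [B], [d] the least loss and [p] the size of the palette, then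
    [d * d <= n * d <= 2 * (p - 1)]. Deleting a vertex that attains [d] takes the
    number of colours from [p > m] to [p - d < m], so the closer of these two
    values is within [d / 2] of [m], and the quadratic bound on [d] turns this
    into the square root of [m / 2] plus one half. *)

(** * Palettes of finite vertex sets *)

(** The values [e v v] are genuine colours, those of the loops at [v]; they encode
    the edges from [v] to the infinite homogeneous set. *)
Definition palette (V C : finType) (e : V -> V -> C) (c0 : C) (B : {set V}) :
  {set C} := (c0 |: [set e u v | u in B, v in B])%SET.

Lemma in_palette (V C : finType) (e : V -> V -> C) (c0 : C) (B : {set V}) c :
  reflect (c = c0 \/ exists u v, [/\ u \in B, v \in B & c = e u v])
          (c \in palette e c0 B).
Proof.
rewrite finset.in_setU1; apply: (iffP orP) => [[/eqP ->|/imset2P[u v uB vB ->]]|].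
- by left.
- by right; exists u, v.
- case=> [->|[u [v [uB vB ->]]]]; first by left.
  by right; apply: imset2_f.
Qed.

Definition lost (V C : finType) (e : V -> V -> C) (c0 : C) (B : {set V}) (v : V) :
  {set C} := (palette e c0 B :\: palette e c0 (B :\ v))%SET.

Lemma paletteS (V C : finType) (e : V -> V -> C) (c0 : C) (A B : {set V}) :
  A \subset B -> palette e c0 A \subset palette e c0 B.
Proof.
move=> /fintype.subsetP AB; apply/fintype.subsetP => c.
case/in_palette=> [->|[u [v [uA vA ->]]]].
  by apply/in_palette; left.
by apply/in_palette; right; exists u, v; split; rewrite // AB.
Qed.

Lemma card_lost (V C : finType) (e : V -> V -> C) (c0 : C) (B : {set V}) v :
  (#|palette e c0 (B :\ v)%SET| + #|lost e c0 B v| = #|palette e c0 B|)%N.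
Proof.
rewrite -(cardsID (palette e c0 (B :\ v)%SET) (palette e c0 B)).
by congr (_ + _)%N; congr #|pred_of_set _|;
  apply/esym/finset.setIidPr/paletteS/finset.subD1set.
Qed.

Lemma lost_edge (V C : finType) (e : V -> V -> C) (c0 : C) (B : {set V}) v u w :
  u \in B -> w \in B -> e u w \in lost e c0 B v -> v \in [set u; w]%SET.
Proof.
move=> uB wB; rewrite finset.in_setD => /andP[H _]; apply: contraR H.
rewrite finset.in_set2 negb_or => /andP[vu vw]; apply/in_palette; right.
by exists u, w; rewrite !finset.in_setD1 uB wB !(eq_sym _ v) vu vw.
Qed.

Lemma lostP (V C : finType) (e : V -> V -> C) (c0 : C) (B : {set V}) v c :
  c \in lost e c0 B v ->
  exists u w, [/\ u \in B, w \in B & c = e u w].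
Proof.
rewrite finset.in_setD => /andP[H /in_palette[cc0|//]]; exfalso.
by move/in_palette: H => H; apply: H; left.
Qed.

(** A lost colour sits on an edge or loop at [v], and there are [#|B|] of these
    when [v] is in [B]. *)
Lemma card_lost_le (V C : finType) (e : V -> V -> C) (c0 : C) (B : {set V}) v :
  (forall x y, e x y = e y x) -> (#|lost e c0 B v| <= #|B|)%N.
Proof.
move=> esym; apply: leq_trans (leq_imset_card (e v) (mem B)).
apply/subset_leq_card/fintype.subsetP => c cl.
have [u [w [uB wB cE]]] := lostP cl; move: cl; rewrite cE => /(lost_edge uB wB).
rewrite finset.in_set2 => /orP[]/eqP ->; first exact: imset_f.
by rewrite esym; apply: imset_f.
Qed.

(** Double counting of pairs (vertex, colour it loses): the colour [c0] is never
    lost, and any other colour sits on some edge [u w], so only the deletions of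
    [u] and [w] can lose it. *)
Lemma sum_card_lost (V C : finType) (e : V -> V -> C) (c0 : C) (B : {set V}) :
  (\sum_(v in B) #|lost e c0 B v| + 2 <= 2 * #|palette e c0 B|)%N.
Proof.
have c0P : c0 \in palette e c0 B by apply/in_palette; left.
have -> : (2 * #|palette e c0 B| = \sum_(c in palette e c0 B :\ c0) 2 + 2)%N.
  by rewrite (cardsD1 c0) c0P sum_nat_const; lia.
rewrite leq_add2r.
under eq_bigr do rewrite -sum1_card.
rewrite (exchange_big_dep (fun c => c \in palette e c0 B :\ c0)%SET); last first.
  move=> v c _; rewrite finset.in_setD1 finset.in_setD => /andP[H ->]; rewrite andbT.
  by apply: contra H => /eqP ->; apply/in_palette; left.
apply: leq_sum => c; rewrite finset.in_setD1 => /andP[cc0 /in_palette[cE|]].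
  by rewrite cE eqxx in cc0.
move=> [u [w [uB wB ->]]]; rewrite sum1dep_card.
have : (#|[set u; w]%SET| <= 2)%N by rewrite cards2; case: eqP.
apply: leq_trans; apply/subset_leq_card/fintype.subsetP => v.
by rewrite inE => /andP[_]; apply: lost_edge.
Qed.

(** The condition on [r] is [(r - 1/2)^2 <= m/2 - 1/4] cleared of denominators,
    which implies [r <= sqrt (m/2) + 1/2]. *)
Lemma palette_near (V C : finType) (e : V -> V -> C) (c0 : C) (m : nat) :
  (forall x y, e x y = e y x) ->
  (0 < m)%N -> (m <= #|palette e c0 [set: V]%SET|)%N ->
  exists B r, [/\ (2 * (r * r) + 1 <= m + 2 * r)%N,
    (m <= #|palette e c0 B| + r)%N & (#|palette e c0 B| <= m + r)%N].
Proof.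
move=> esym m0 mT.
have [B /minsetP[mB minB] _] := minset_exists
  (P := fun B => (m <= #|palette e c0 B|)%N) mT.
have [Bm|mltB] := leqP #|palette e c0 B| m.
  by exists B, 0%N; split; lia.
have [v0 v0B] : exists v, v \in B.
  apply/finset.set0Pn; apply: contraTneq mltB => ->; rewrite -leqNgt /palette.
  rewrite (_ : imset2 _ _ _ = finset.set0) ?finset.setU0 ?cards1 //.
  by apply/setP => c; rewrite inE; apply/imset2P => -[u w]; rewrite inE.
case: (arg_minnP (fun v => #|lost e c0 B v|) v0B) => v vB' vmin.
have vB : v \in B := vB'.
have sumB := sum_card_lost e c0 B.
have dn := card_lost_le c0 B v esym.
have nd : (#|B| * #|lost e c0 B v| <= \sum_(u in B) #|lost e c0 B u|)%N.
  by rewrite -sum_nat_const; apply: leq_sum => u; apply: vmin.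
have pE := card_lost e c0 B v.
have vltm : (#|palette e c0 (B :\ v)%SET| < m)%N.
  rewrite ltnNge; apply/negP => /minB /(_ (finset.subD1set _ _)) BE.
  by move: vB; rewrite -BE finset.in_setD1 eqxx.
have dd : (#|lost e c0 B v| * #|lost e c0 B v| <= #|B| * #|lost e c0 B v|)%N.
  by rewrite leq_mul2r dn orbT.
have {dd nd sumB} : (#|lost e c0 B v| * #|lost e c0 B v| + 2 <=
  2 * #|palette e c0 B|)%N by lia.
(* The loss [a + b] splits into the excess [a] of B and the deficit [b] of B
   without v. The quadratic bound reads [(a + b)^2 + 2 <= 2 (m + a)]; since
   [(a + b)^2 - 2 a] does not decrease in [a >= 1], replacing [a] and [b] by
   [r = min a b] gives [4 r^2 + 2 <= 2 (m + r)], more than required of [r]. *)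
have [a pa] : exists a, #|palette e c0 B| = (m + a)%N.
  by exists (#|palette e c0 B| - m)%N; lia.
have [b mb] : exists b, m = (#|palette e c0 (B :\ v)%SET| + b)%N.
  by exists (m - #|palette e c0 (B :\ v)%SET|)%N; lia.
have -> : #|lost e c0 B v| = (a + b)%N by lia.
rewrite pa => dd; have [ab|ba] := leqP a b.
  by exists B, a; split; [nia | lia | lia].
by exists (B :\ v)%SET, b; split; [nia | lia | lia].
Qed.

Lemma sqrt_bound (R : realType) (m p r : nat) :
  (2 * (r * r) + 1 <= m + 2 * r)%N -> (m <= p + r)%N -> (p <= m + r)%N ->
  `|m%:R - p%:R| <= Num.sqrt (m%:R / 2) + 1 / 2 :> R.
Proof.
move=> hr h1 h2.
have {}h1 : m%:R <= p%:R + r%:R :> R by rewrite -natrD ler_nat.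
have {}h2 : p%:R <= m%:R + r%:R :> R by rewrite -natrD ler_nat.
apply: (@le_trans _ _ r%:R); first by rewrite ler_norml; apply/andP; split; lra.
have hrR : 2 * (r%:R * r%:R) + 1 <= m%:R + 2 * r%:R :> R.
  by move: hr; rewrite -(ler_nat R) !natrD !natrM => hr; lra.
have [rle|rgt] := leP (r%:R : R) (1 / 2).
  by have s0 := sqrtr_ge0 (m%:R / 2 : R); lra.
rewrite -lerBlDr -[leLHS]ger0_norm; last lra.
rewrite -sqrtr_sqr; apply: ler_wsqrtr; rewrite expr2; nra.
Qed.

(** * Homogeneous infinite sets from an ultrafilter *)

Lemma ultra_colour (T : Type) (C : finType) (F : set_system T) (g : T -> C) :
  UltraFilter F -> exists x, F [set t | g t = x].
Proof.
move=> FU; apply: contrapT => /forallNP nF.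
have FN x : F [set t | g t <> x].
  by have [|//] := in_ultra_setVsetC [set t | g t = x] FU => /nF.
have : F [set t | forall x, g t <> x] by apply: filter_forall.
by case/filter_ex => t /(_ (g t)); apply.
Qed.

(** Ramsey's theorem for pairs is the case [A] empty. The elements of [Y] are
    picked one after the other: being joined to every earlier vertex [a] in the
    colour [f a] and having [f]-colour [c0] are finitely many conditions, each in
    the ultrafilter, so they can be met together. *)
Lemma homogeneous_tail (C : finType) (d : nat -> nat -> C) (A : seq nat) :
  exists (f : nat -> C) (c0 : C) (Y : set nat),
  [/\ infinite_set Y,
      forall y a, Y y -> a \in A -> (a < y)%N /\ d a y = f a &
      forall y z, Y y -> Y z -> (y < z)%N -> d y z = c0].
Proof.
have [U [UU oU]] := ultraFilterLemma eventually_filter.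
have [f Uf] := choice (fun a => ultra_colour (d a) UU).
have [c0 Uc0] : exists c0, U [set k | f k = c0] by apply: ultra_colour.
pose good (s : seq nat) k :=
  f k = c0 /\ forall a, a \in s -> (a < k)%N /\ d a k = f a.
have Ugood s : U (good s).
  elim: s => [|a s IHs]; first by apply: filterS Uc0 => k.
  have Ua : U [set k | (a < k)%N] by apply: oU; exists a.+1.
  apply: filterS (filterI (filterI Ua (Uf a)) IHs) => k [[ak dak] [fk gs]].
  by split=> // b; rewrite in_cons => /orP[/eqP -> //|/gs].
have [nxt nxtP] := choice (fun s => filter_ex (Ugood s)).
(* All vertices to be respected by the n-th pick, the initial [A] included. *)
pose hist n := iter n (fun s => nxt s :: s) A.
pose y n := nxt (hist n).
have histS n a : a \in A -> a \in hist n.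
  by move=> aA; elim: n => //= n IHn; rewrite in_cons IHn orbT.
have yhist i j : (i < j)%N -> y i \in hist j.
  elim: j => // j IHj; rewrite ltnS leq_eqVlt => /orP[/eqP ->|/IHj ij] /=.
    by rewrite mem_head.
  by rewrite in_cons ij orbT.
have ylt i j : (i < j)%N -> (y i < y j)%N.
  by move=> /yhist /(nxtP (hist j)).2[].
have yle i j : (y i < y j)%N -> (i < j)%N.
  by case: (ltngtP i j) => [//|/ylt /ltnW|->]; rewrite ?ltnn // leqNgt => /negP.
exists f, c0, (range y); split.
- apply/infiniteP; rewrite -(card_le_eql (inj_card_eq (f := y) (A := setT) _)).
    exact: card_lexx.
  move=> i j _ _ yij; case: (ltngtP i j) => // /ylt; by rewrite yij ltnn.
- move=> _ a [n _ <-] aA; exact: (nxtP (hist n)).2 _ (histS n a aA).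
- move=> _ _ [i _ <-] [j _ <-] /yle /yhist ij.
  by rewrite ((nxtP (hist j)).2 _ ij).2 (nxtP (hist i)).1.
Qed.

(** * Edges and cardinalities *)

Lemma card_set2 (i j : nat) : i != j -> ([set i; j] #= `I_2)%card.
Proof.
move=> ij; apply/(eq_cardSP _ 1); exists i; first by left.
rewrite (_ : _ `\` _ = [set j]); first exact: card_set1.
apply/seteqP; split=> [x [[->|->]]|x ->] //=.
by split; [right|move=> ji; rewrite ji eqxx in ij].
Qed.

Lemma edgesP (X : set nat) (e : set nat) :
  edges X e <-> exists i j, [/\ X i, X j, (i < j)%N & e = [set i; j]].
Proof.
split=> [[eX e2] | [i [j [Xi Xj ij ->]]]]; last first.
  split; first by move=> x [->|->].
  by apply: card_set2; rewrite neq_ltn ij.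
have [i ei /eq_cardSP[j [ej /eqP ji] r0]] := elimT (eq_cardSP _ 1) e2.
have {}r0 : forall x, e x -> x = i \/ x = j.
  move=> x ex; apply: contrapT => /not_orP[xi xj].
  by move: r0; rewrite II0 card_eq0 => /eqP r0; suff : set0 x by []; rewrite -r0.
have eE : e = [set i; j].
  by apply/seteqP; split=> [x /r0[->|->]|x [->|->]] //; [left | right].
have [ij|ji'|ij] := ltngtP i j.
- by exists i, j; split=> //; apply: eX.
- by exists j, i; split; rewrite ?eE 1?setUC //; apply: eX.
- by rewrite ij eqxx in ji.
Qed.

Lemma card_finset (T : finType) (S : {set T}) : ([set` S] #= `I_#|S|)%card.
Proof.
have -> : [set` S] = enum_val (A := mem S) @` [set: 'I_#|S|].
  apply/seteqP; split=> x /= => [xS|[i _ <-]]; last exact: enum_valP.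
  by exists (enum_rank_in xS x); rewrite // enum_rankK_in.
have -> : ((enum_val (A := mem S) @` [set: 'I_#|S|] #= `I_#|S|) =
           ([set: 'I_#|S|] #= `I_#|S|))%card.
  by apply/card_eql/inj_card_eq => i j _ _; apply: enum_val_inj.
by rewrite card_eq_sym; apply: card_II.
Qed.

(** The codomain has one element more than needed, so that it is inhabited and
    [h] can be total even when [A] is empty. *)
Lemma finite_set_coding (K : Type) (A : set K) :
  finite_set A -> exists n, exists h : K -> 'I_n.+1, {in A &, injective h}.
Proof.
move=> [n /card_eqPle[/pcard_leP[f] _]].
have fn x : x \in A -> (f x < n.+1)%N.
  by move=> /set_mem xP; have /ltnW := 'funS_f xP.
exists n, (fun x => inord (f x)) => x y xA yA fxy.
have := congr1 val fxy; rewrite /= !inordK ?fn //.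
by apply: 'inj_f.
Qed.

(** * The theorem *)

Theorem mainTheorem2 (R : realType) (m : nat) (hm : (0 < m)%N)
    (K : Type) (c : set nat -> K)
    (hfin : finite_set (colours c posN))
    (hmany : (`I_m #<= colours c posN)%card) :
  exists mh : nat,
    [/\ (0 < mh)%N,
        `|m%:R - mh%:R| <= Num.sqrt (m%:R / 2) + 1 / 2 :> R &
        exists X : set nat,
          [/\ X `<=` posN, infinite_set X & (colours c X #= `I_mh)%card]].
Proof.
have [n [h hinj]] := finite_set_coding hfin.
pose d i j := h (c [set i; j]).
have colE X : h @` colours c X =
    [set k | exists i j, [/\ X i, X j, (i < j)%N & d i j = k]].
  apply/seteqP; split=> k /=.
    by move=> [_ [e /edgesP[i [j [Xi Xj ij ->]]] <-] <-]; exists i, j.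
  move=> [i [j [Xi Xj ij <-]]]; exists (c [set i; j]) => //.
  by exists [set i; j] => //; apply/edgesP; exists i, j.
have cardE X : X `<=` posN -> (colours c X #= h @` colours c X)%card.
  move=> XP; rewrite card_eq_sym; apply: inj_card_eq => x y /set_mem xX /set_mem yX.
  have cX : colours c X `<=` colours c posN.
    by apply: image_subset => e [eX e2]; split=> // z /eX /XP.
  by apply: hinj; apply/mem_set/cX.
(* Fix one edge per colour; an index that is not the colour of any edge gets the
   dummy pair (1, 1), whose entries are still positive. The finite vertex set is
   the type of ends of these edges, mapped to the naturals by [w]. If [w] gives
   two ends the same vertex, [e] sees the pair as a loop, so that the palette is
   still the set of colours on [X B]. *)
have ex_edge (k : 'I_n.+1) : exists p : nat * nat, [/\ (0 < p.1)%N, (0 < p.2)%N &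
    (h @` colours c posN) k -> (p.1 < p.2)%N /\ d p.1 p.2 = k].
  have [|nk] := pselect ((h @` colours c posN) k); last by exists (1, 1)%N.
  by rewrite colE => -[i [j [Xi Xj ij dk]]]; exists (i, j).
have [s sP] := choice ex_edge.
pose w (x : 'I_n.+1 * bool) := if x.2 then (s x.1).1 else (s x.1).2.
have w0 x : (0 < w x)%N by rewrite /w; have [] := sP x.1; case: x.2.
(* Listing 0 among the vertices to be exceeded keeps [Y] inside the positives. *)
have [f [c0 [Y [Yinf Yf Yd]]]] := homogeneous_tail d (0%N :: codom w).
have wY x y : Y y -> (w x < y)%N /\ d (w x) y = f (w x).
  by move=> Yy; apply: Yf; rewrite // in_cons codom_f orbT.
pose e x y := if w x == w y then f (w x) else d (w x) (w y).
have eC x y : e x y = e y x.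
  by rewrite /e eq_sym; case: eqP => [->//|_]; rewrite /d setUC.
pose X (B : {set 'I_n.+1 * bool}) := w @` [set` B] `|` Y.
have XP B : X B `<=` posN.
  move=> z [[x _ <-]|Yz]; first exact: w0.
  by have [] := Yf z 0%N Yz (mem_head _ _).
have [y0 Yy0] := infinite_setN0 Yinf.
have XE B : h @` colours c (X B) = [set` palette e c0 B].
  rewrite colE; apply/seteqP; split=> k /=.
    move=> [i [j [[[x xB <-]|Yi] [[y yB <-]|Yj] ij <-]]]; apply/in_palette.
    - by right; exists x, y; split; rewrite // /e ltn_eqF.
    - by right; exists x, x; split; rewrite // /e eqxx (wY x j Yj).2.
    - by have [] := wY y i Yi; rewrite ltnNge ltnW.
    - by left; apply: Yd.
  move=> /in_palette[->|[x [y [xB yB ->]]]].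
    have [z [Yz /eqP zy0]] := infinite_setN0 (infinite_setD Yinf (finite_set1 y0)).
    have [zy|yz|zy] := ltngtP z y0; last by rewrite zy eqxx in zy0.
      by exists z, y0; split; [right|right|..|apply: Yd].
    by exists y0, z; split; [right|right|..|apply: Yd].
  rewrite /e; have [xy|yx|xy] := ltngtP (w x) (w y).
  - by exists (w x), (w y); split=> //; left; [exists x | exists y].
  - exists (w y), (w x); split=> //; last by rewrite /d setUC.
      by left; exists y.
    by left; exists x.
  - have [xy0 dE] := wY x y0 Yy0.
    by exists (w x), y0; split=> //; [left; exists x | right].
have XI B : (colours c (X B) #= `I_#|palette e c0 B|)%card.
  by apply: card_eq_trans (cardE _ (@XP B)) _; rewrite XE; apply: card_finset.
have mT : (m <= #|palette e c0 [set: 'I_n.+1 * bool]%SET|)%N.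
  rewrite -card_le_II; apply: card_le_trans hmany _.
  have /card_eqPle[+ _] := cardE posN (fun _ => id) => /card_le_trans; apply.
  have /card_eqPle[+ _] := XI [set: 'I_n.+1 * bool]%SET => /(card_le_trans _); apply.
  have /card_eqPle[_ +] := cardE _ (XP [set: 'I_n.+1 * bool]%SET).
  move=> /(card_le_trans _); apply; apply: subset_card_le => k kc.
  have [s1 s2 /(_ kc)[s12 <-]] := sP k.
  rewrite colE; exists (s k).1, (s k).2; split=> //; left.
    by exists (k, true); rewrite //= finset.in_setT.
  by exists (k, false); rewrite //= finset.in_setT.
have [B [r [hr pB Bp]]] := palette_near eC hm mT.
exists #|palette e c0 B|; split.
- by apply/card_gt0P; exists c0; apply/in_palette; left.
- exact: sqrt_bound hr pB Bp.
- exists (X B); split; [exact: XP | | exact: XI].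
  by apply: sub_infinite_set Yinf => y Yy; right.
Qed.
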